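(* The class $\mathbf{OBD}$ of all ordered Bratteli diagrams, with ordered morphisms (equivalence classes $[f]$ of ordered premorphisms) as arrows and with composition $[g][f]=[gf]$, is a category. Two ordered Bratteli diagrams are isomorphic in this category if and only if they are equivalent in the sense of Herman, Putnam, and Skau.
   Context: **Bratteli diagrams.** A Bratteli diagram $(V,E)$ consists of a vertex set $V=V_0\sqcup V_1\sqcup\cdots$ with each $V_n$ finite and non-empty and $V_0$ a singleton, and an edge set $E=E_1\sqcup E_2\sqcup\cdots$ with each $E_n$ finite and non-empty, together with maps $r,s:E\to V$ (range, source) such that $r(E_n)\subseteq V_n$, $s(E_n)\subseteq V_{n-1}$, $s^{-1}\{v\}\neq\varnothing$ for all $v\in V$ and $r^{-1}\{v\}\ne\varnothing$ for all $v\in V\setminus V_0$. An ordered Bratteli diagram $(V,E,\geq)$ is a Bratteli diagram with a partial order on $E$ such that $e,e'$ are comparable iff $r(e)=r(e')$ (so each $r^{-1}\{v\}$ is linearly ordered). **Edge sets.** An ordered edge set from a finite set $S$ to a finite set $T$ is a finite set $F$ with maps $s:F\to S$, $r:F\to T$ and a linear order on each $r^{-1}\{w\}$, $w\in T$. If $G$ is an ordered edge set from $T$ to $U$, then $F\circ G=\{(e,g)\in F\times G: r(e)=s(g)\}$, with source $s(e)$, range $r(g)$, and the induced (lexicographic) order: for $r(g)=r(g')$, $(e,g)<(e',g')$ iff $g<g'$, or $g=g'$ and $e<e'$. Write $F\cong F'$ if there is a (necessarily unique) bijection $F\to F'$ preserving sources, ranges and order. For $k<l$, $E_{k,l}=E_{k+1}\circ\cdots\circ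 E_l$ (paths from $V_k$ to $V_l$); $E_{k,k}$ consists of one edge from $v$ to $v$ for each $v\in V_k$. **Ordered premorphisms.** Let $B=(V,E,\geq)$, $C=(W,S,\geq)$ be ordered Bratteli diagrams. An ordered premorphism $f:B\to C$ is a triple $(F,(f_n)_{n\ge0},\geq)$ where $(f_n)$ is an unbounded sequence of integers with $0=f_0\le f_1\le f_2\le\cdots$, and $F=F_0\sqcup F_1\sqcup\cdots$ where each $F_n$ is a non-empty finite ordered edge set from $V_n$ to $W_{f_n}$ such that every $v\in V_n$ is the source and every $w\in W_{f_n}$ the range of some edge of $F_n$, $F_0$ is a singleton, and $E_{n+1}\circ F_{n+1}\cong F_n\circ S_{f_n,f_{n+1}}$ for all $n\ge0$. **Composition.** For $f=(F,(f_n),\ge):B\to C$ and $g=(G,(g_n),\ge):C\to D$, $gf=(H,(h_n),\ge)$ with $h_n=g_{f_n}$ and $H_n=F_n\circ G_{f_n}$. **Equivalence of premorphisms and morphisms.** Ordered premorphisms $f=(F,(f_n),\ge)$ and $g=(G,(g_n),\ge)$ from $B$ to $C$ are equivalent, $f\sim g$, if there are sequences of positive integers $(n_k)_{k\ge1},(m_k)_{k\ge1}$ with $n_k<m_k<n_{k+1}$ and $f_{n_k}<g_{m_k}<f_{n_{k+1}}$ such that for all $k\ge1$ $$E_{n_k,m_k}\circ G_{m_k}\cong F_{n_k}\circ S_{f_{n_k},g_{m_k}},\qquad E_{m_k,n_{k+1}}\circ F_{n_{k+1}}\cong G_{m_k}\circ S_{g_{m_k},f_{n_{k+1}}}.$$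 This is an equivalence relation; the class of $f$ is the ordered morphism $[f]:B\to C$. **Equivalence of Herman, Putnam, and Skau.** A telescoping of $(V,E,\ge)$ along $0=n_0<n_1<n_2<\cdots$ is the ordered Bratteli diagram with $k$-th vertex set $V_{n_k}$ and $k$-th edge set $E_{n_{k-1},n_k}$ with its induced order. Two ordered Bratteli diagrams are isomorphic in the sense of Herman, Putnam, and Skau if there are level-preserving bijections of vertices and of edges intertwining source and range maps and preserving the order. Equivalence in the sense of Herman, Putnam, and Skau is the equivalence relation on ordered Bratteli diagrams generated by this isomorphism and by telescoping. *)

(* Defs.v *)
From mathcomp Require Import all_boot.
From Stdlib Require Import Relation_Operators RelationClasses ClassicalEpsilon.

Set Implicit Arguments.
Unset Strict Implicit.
Unset Printing Implicit Defensive.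

(* The linear orders on the fibres of [rng] are packed into one partial order
   on the whole edge set, for which two edges are comparable exactly when they
   have the same range. *)
Record oedge (S T : finType) := OEdge {
  edge :> finType;
  src : edge -> S;
  rng : edge -> T;
  ele : rel edge;
  ele_refl : reflexive ele;
  ele_anti : antisymmetric ele;
  ele_trans : transitive ele;
  ele_comparable : forall e e', (ele e e' || ele e' e) = (rng e == rng e')
}.

Definition full_edges (S T : finType) (F : oedge S T) : Prop :=
  (forall v : S, exists e : F, src e = v) /\
  (forall w : T, exists e : F, rng e = w).

Definition oiso (S T : finType) (F F' : oedge S T) : Prop :=
  exists phi : F -> F',
    [/\ bijective phi,
        forall e, src (phi e) = src e,
        forall e, rng (phi e) = rng e &
        forall e e', ele (phi e) (phi e') = ele e e'].

Section Composition.
Variables (S T U : finType) (F : oedge S T) (G : oedge T U).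

Definition ocomp_edge : finType := {p : F * G | rng p.1 == src p.2}.

Definition ocomp_le : rel ocomp_edge := fun p q =>
  let: (e, g) := val p in let: (e', g') := val q in
  (g != g') && ele g g' || (g == g') && ele e e'.

Fact ocomp_refl : reflexive ocomp_le.
Proof. by case=> [[e g] h]; rewrite /ocomp_le /= eqxx /= ele_refl. Qed.

Fact ocomp_anti : antisymmetric ocomp_le.
Proof.
case=> [[e g] h] [[e' g'] h']; rewrite /ocomp_le /= => H; apply: val_inj => /=.
move: H; rewrite (eq_sym g' g); case: eqP => [->|ne] /= H.
  by rewrite (ele_anti H).
by rewrite !orbF in H; case: ne; apply: ele_anti.
Qed.

Fact ocomp_trans : transitive ocomp_le.
Proof.
case=> [[e g] h] [[e' g'] h'] [[e'' g''] h'']; rewrite /ocomp_le /=.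
case: (eqVneq g' g) => [->|n1] /=; case: (eqVneq g g'') => [E|n2] //=.
- exact: ele_trans.
- by rewrite -E n1 orbF => ->.
rewrite !orbF => H1 H2; case: (eqVneq g' g'') => [E|_] /=.
  by subst g''; rewrite (@ele_anti _ _ G g g') ?eqxx ?H1 ?H2 // in n1.
by rewrite (ele_trans H1 H2).
Qed.

Fact ocomp_comparable p q :
  (ocomp_le p q || ocomp_le q p) = (rng (val p).2 == rng (val q).2).
Proof.
case: p q => [[e g] h] [[e' g'] h']; rewrite /ocomp_le /=.
case: (eqVneq g g') => [E|n] /=; last by rewrite !orbF ele_comparable.
by subst g'; rewrite ele_comparable !eqxx (eqP h) (eqP h') eqxx.
Qed.

Definition ocomp : oedge S U :=
  @OEdge S U ocomp_edge (fun p => src (val p).1) (fun p => rng (val p).2)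
    ocomp_le ocomp_refl ocomp_anti ocomp_trans ocomp_comparable.

End Composition.

Section Identity.
Variable S : finType.

Fact oid_refl : reflexive (@eq_op S). Proof. exact: eqxx. Qed.
Fact oid_anti : antisymmetric (@eq_op S).
Proof. by move=> x y /andP[/eqP]. Qed.
Fact oid_trans : transitive (@eq_op S).
Proof. by move=> y x z /eqP-> /eqP->. Qed.
Fact oid_comparable (x y : S) : ((x == y) || (y == x)) = (x == y).
Proof. by rewrite (eq_sym y) orbb. Qed.

Definition oid : oedge S S :=
  @OEdge S S S id id eq_op oid_refl oid_anti oid_trans oid_comparable.

End Identity.

Definition oempty (S T : finType) : oedge S T.
Proof.
by refine (@OEdge S T void (fun x => match x with end)
  (fun x => match x with end) (fun _ _ => true) _ _ _ _); case.
Defined.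

(* [edges n] is the edge set E_(n+1), from V_n to V_(n+1). *)
Record obd := OBD {
  vert : nat -> finType;
  edges : forall n, oedge (vert n) (vert n.+1);
  vert_neq0 : forall n, 0 < #|vert n|;
  vert0_card : #|vert 0| = 1;
  edges_neq0 : forall n, 0 < #|edges n|;
  edges_full : forall n, full_edges (edges n)
}.

Section Paths.
Variable B : obd.

Definition path_diag (k l : nat) : oedge (vert B k) (vert B l) :=
  match @eqP _ k l with
  | ReflectT e => ecast l (oedge (vert B k) (vert B l)) e (oid (vert B k))
  | ReflectF _ => oempty _ _
  end.

(* The set E_(k,l) of paths from V_k to V_l.  Junk value: it is empty when
   l < k.  For k < l it is E_(k,k) o E_(k+1) o ... o E_l, bracketed to the
   left; the leading identity E_(k,k) makes no difference up to [oiso]. *)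
Fixpoint epath (k l : nat) : oedge (vert B k) (vert B l) :=
  match l with
  | 0 => path_diag k 0
  | m.+1 => if k <= m then ocomp (epath k m) (edges B m) else path_diag k m.+1
  end.

End Paths.

Section IsoTheory.

Lemma oiso_refl (S T : finType) (F : oedge S T) : oiso F F.
Proof. by exists id; split=> //; exists id. Qed.

Lemma oiso_sym (S T : finType) (F G : oedge S T) : oiso F G -> oiso G F.
Proof.
case=> phi [[psi K1 K2] hs hr hl]; exists psi; split.
- by exists phi.
- by move=> e; rewrite -hs K2.
- by move=> e; rewrite -hr K2.
- by move=> e e'; rewrite -hl !K2.
Qed.

Lemma oiso_trans (S T : finType) (F G H : oedge S T) :
  oiso F G -> oiso G H -> oiso F H.
Proof.
case=> phi [b1 hs hr hl] [psi [b2 hs' hr' hl']]; exists (psi \o phi); split.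
- exact: bij_comp.
- by move=> e /=; rewrite hs' hs.
- by move=> e /=; rewrite hr' hr.
- by move=> e e' /=; rewrite hl' hl.
Qed.

Lemma oiso_comp (S T U : finType) (F F' : oedge S T) (G G' : oedge T U) :
  oiso F F' -> oiso G G' -> oiso (ocomp F G) (ocomp F' G').
Proof.
case=> phi [b1 hs hr hl] [psi [b2 hs' hr' hl']].
have P (p : ocomp F G) : rng (phi (val p).1) == src (psi (val p).2).
  by rewrite hr hs' (valP p).
pose chi (p : ocomp F G) : ocomp F' G' :=
  exist (fun q : F' * G' => rng q.1 == src q.2) (phi (val p).1, psi (val p).2) (P p).
exists chi; split=> //=.
- case: b1 b2 => phi' K1 K1' [psi' K2 K2'].
  have Q (q : ocomp F' G') : rng (phi' (val q).1) == src (psi' (val q).2).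
    by rewrite -hr -hs' K1' K2' (valP q).
  exists (fun q => exist (fun p : F * G => rng p.1 == src p.2)
                     (phi' (val q).1, psi' (val q).2) (Q q)).
  + by case=> [[e g] h]; apply: val_inj; rewrite /= K1 K2.
  + by case=> [[e g] h]; apply: val_inj; rewrite /= K1' K2'.
- case=> [[e g] h] [[e' g'] h'] /=; rewrite /ocomp_le /= hl hl'.
  by rewrite (inj_eq (bij_inj b2)).
Qed.

Lemma oiso_assoc (S T U W : finType) (F : oedge S T) (G : oedge T U)
    (H : oedge U W) : oiso (ocomp (ocomp F G) H) (ocomp F (ocomp G H)).
Proof.
have P1 (p : ocomp (ocomp F G) H) : rng (val (val p).1).2 == src (val p).2.
  exact: (valP p).
pose a1 (p : ocomp (ocomp F G) H) : ocomp G H :=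
  exist (fun q : G * H => rng q.1 == src q.2) ((val (val p).1).2, (val p).2) (P1 p).
have P2 (p : ocomp (ocomp F G) H) : rng (val (val p).1).1 == src (a1 p).
  exact: (valP (val p).1).
pose a (p : ocomp (ocomp F G) H) : ocomp F (ocomp G H) :=
  exist (fun q : F * ocomp G H => rng q.1 == src q.2)
    ((val (val p).1).1, a1 p) (P2 p).
have Q1 (p : ocomp F (ocomp G H)) : rng (val p).1 == src (val (val p).2).1.
  exact: (valP p).
pose b1 (p : ocomp F (ocomp G H)) : ocomp F G :=
  exist (fun q : F * G => rng q.1 == src q.2) ((val p).1, (val (val p).2).1) (Q1 p).
have Q2 (p : ocomp F (ocomp G H)) : rng (b1 p) == src (val (val p).2).2.
  exact: (valP (val p).2).
exists a; split=> //.
  exists (fun p => exist (fun q : ocomp F G * H => rng q.1 == src q.2)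
    (b1 p, (val (val p).2).2) (Q2 p)).
  - case=> [[[[e g] h] k] l]; apply: val_inj => /=; congr pair.
    exact: val_inj.
  - case=> [[e [[g k] h]] l]; apply: val_inj => /=; congr pair.
    exact: val_inj.
case=> [[[[e g] h] k] l] [[[[e' g'] h'] k'] l'] /=.
rewrite /ocomp_le /= /ocomp_le /= -!val_eqE /= !xpair_eqE.
by case: (k == k'); case: (g == g') => //=; rewrite ?orbF ?andbF ?orbT.
Qed.

Lemma oiso_idl (S T : finType) (F : oedge S T) : oiso (ocomp (oid S) F) F.
Proof.
exists (fun p : ocomp (oid S) F => (val p).2); split=> //.
- have P (e : F) : rng (src e : oid S) == src e by exact: eqxx.
  exists (fun e => exist (fun q : oid S * F => rng q.1 == src q.2) (src e, e) (P e)).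
  + by case=> [[e g] h]; apply: val_inj; rewrite /= -(eqP h).
  + by [].
- by case=> [[e g] h] /=; rewrite -(eqP h).
- case=> [[e g] h] [[e' g'] h'] /=; rewrite /ocomp_le /=.
  case: eqVneq => [E|] /=; last by rewrite orbF.
  by subst g'; rewrite ele_refl; move: h h' => /= /eqP-> /eqP->; rewrite eqxx.
Qed.

Lemma oiso_idr (S T : finType) (F : oedge S T) : oiso (ocomp F (oid T)) F.
Proof.
exists (fun p : ocomp F (oid T) => (val p).1); split=> //.
- have P (e : F) : rng e == src (rng e : oid T) by exact: eqxx.
  exists (fun e => exist (fun q : F * oid T => rng q.1 == src q.2) (e, rng e) (P e)).
  + by case=> [[e g] h]; apply: val_inj; rewrite /= (eqP h).
  + by [].
- by case=> [[e g] h] /=; rewrite (eqP h).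
- case=> [[e g] h] [[e' g'] h'] /=; rewrite /ocomp_le /=.
  case: eqVneq => //= n; apply/negP=> l.
  have := ele_comparable e e'; rewrite l (eqP h) (eqP h') /=.
  by rewrite (negbTE n).
Qed.

Lemma full_comp (S T U : finType) (F : oedge S T) (G : oedge T U) :
  full_edges F -> full_edges G -> full_edges (ocomp F G).
Proof.
case=> sF rF [sG rG]; split.
  move=> v; case: (sF v) => e <-; case: (sG (rng e)) => g E.
  have h : rng (e, g).1 == src (e, g).2 by rewrite E.
  by exists (exist (fun q : F * G => rng q.1 == src q.2) (e, g) h).
move=> w; case: (rG w) => g <-; case: (rF (src g)) => e E.
have h : rng (e, g).1 == src (e, g).2 by rewrite E.
by exists (exist (fun q : F * G => rng q.1 == src q.2) (e, g) h).
Qed.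

Lemma full_neq0 (S T : finType) (F : oedge S T) :
  0 < #|S| -> full_edges F -> 0 < #|F|.
Proof. by case/card_gt0P=> v _ [/(_ v)[e _] _]; apply/card_gt0P; exists e. Qed.

End IsoTheory.

Section PathTheory.
Variable B : obd.

Lemma path_diag_id k : path_diag B k k = oid (vert B k).
Proof.
rewrite /path_diag; case: eqP => [e|//].
by rewrite (eq_axiomK e).
Qed.

Lemma epath_id k : epath B k k = oid (vert B k).
Proof. by case: k => [|k] /=; rewrite ?ltnn path_diag_id. Qed.

Lemma epathS k m : k <= m -> epath B k m.+1 = ocomp (epath B k m) (edges B m).
Proof. by move=> /= ->. Qed.

Lemma epath_cat k l m : k <= l -> l <= m ->
  oiso (ocomp (epath B k l) (epath B l m)) (epath B k m).
Proof.
move=> kl; elim: m => [|m IH] lm.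
  have l0 : l = 0 by apply/eqP; rewrite -leqn0.
  by subst l; rewrite (epath_id 0); apply: oiso_idr.
move: lm; rewrite leq_eqVlt => /orP[/eqP El|lm].
  by subst l; rewrite epath_id; apply: oiso_idr.
rewrite !epathS ?(leq_trans kl) //.
apply: oiso_trans (oiso_sym (oiso_assoc _ _ _)) _.
by apply: oiso_comp (IH _) (oiso_refl _).
Qed.

Lemma epath1 k : oiso (epath B k k.+1) (edges B k).
Proof. by rewrite epathS // epath_id; apply: oiso_idl. Qed.

Lemma epath_full k l : k <= l -> full_edges (epath B k l).
Proof.
elim: l => [|l IH] kl.
  have k0 : k = 0 by apply/eqP; rewrite -leqn0.
  by subst k; rewrite (epath_id 0); split=> v; exists v.
move: kl; rewrite leq_eqVlt => /orP[/eqP Ek|kl].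
  by subst k; rewrite epath_id; split=> v; exists v.
by rewrite epathS //; apply: full_comp (IH _) (edges_full B l).
Qed.

End PathTheory.

Record premorphism (B C : obd) := Premorphism {
  pidx : nat -> nat;
  pedges : forall n, oedge (vert B n) (vert C (pidx n));
  pidx0 : pidx 0 = 0;
  pidx_le : forall n, pidx n <= pidx n.+1;
  pidx_unbounded : forall N, exists n, N < pidx n;
  pedges_neq0 : forall n, 0 < #|pedges n|;
  pedges_full : forall n, full_edges (pedges n);
  pedges0_card : #|pedges 0| = 1;
  pedges_comm : forall n,
    oiso (ocomp (edges B n) (pedges n.+1))
         (ocomp (pedges n) (epath C (pidx n) (pidx n.+1)))
}.

Lemma pidx_mono B C (f : premorphism B C) m n : m <= n -> pidx f m <= pidx f n.
Proof.
elim: n => [|n IH]; first by rewrite leqn0 => /eqP->.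
rewrite leq_eqVlt => /orP[/eqP->//|mn].
exact: leq_trans (IH mn) (pidx_le f n).
Qed.

Lemma pedges_path B C (f : premorphism B C) m n : m <= n ->
  oiso (ocomp (epath B m n) (pedges f n))
       (ocomp (pedges f m) (epath C (pidx f m) (pidx f n))).
Proof.
elim: n => [|n IH].
  rewrite leqn0 => /eqP->; rewrite (epath_id B 0) (epath_id C).
  exact: oiso_trans (oiso_idl _) (oiso_sym (oiso_idr _)).
rewrite leq_eqVlt => /orP[/eqP->|mn].
  rewrite !epath_id.
  exact: oiso_trans (oiso_idl _) (oiso_sym (oiso_idr _)).
rewrite epathS //; apply: oiso_trans (oiso_assoc _ _ _) _.
apply: oiso_trans (oiso_comp (oiso_refl _) (pedges_comm f n)) _.
apply: oiso_trans (oiso_sym (oiso_assoc _ _ _)) _.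
apply: oiso_trans (oiso_comp (IH mn) (oiso_refl _)) _.
apply: oiso_trans (oiso_assoc _ _ _) _.
apply: oiso_comp (oiso_refl _) (epath_cat C _ _); last exact: pidx_le.
exact: pidx_mono.
Qed.

Section PremorphismComposition.
Variables (B C D : obd) (f : premorphism B C) (g : premorphism C D).

Definition pcomp_idx n := pidx g (pidx f n).

Definition pcomp_edges n : oedge (vert B n) (vert D (pcomp_idx n)) :=
  ocomp (pedges f n) (pedges g (pidx f n)).

Fact pcomp_idx0 : pcomp_idx 0 = 0.
Proof. by rewrite /pcomp_idx !pidx0. Qed.

Fact pcomp_idx_le n : pcomp_idx n <= pcomp_idx n.+1.
Proof. exact: pidx_mono (pidx_le f n). Qed.

Fact pcomp_idx_unbounded N : exists n, N < pcomp_idx n.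
Proof.
have [m Nm] := pidx_unbounded g N; have [n mn] := pidx_unbounded f m.
by exists n; apply: leq_trans Nm (pidx_mono g (ltnW mn)).
Qed.

Fact pcomp_full n : full_edges (pcomp_edges n).
Proof. exact: full_comp (pedges_full f n) (pedges_full g _). Qed.

Fact pcomp_neq0 n : 0 < #|pcomp_edges n|.
Proof. exact: full_neq0 (vert_neq0 B n) (pcomp_full n). Qed.

Fact pcomp0_card : #|pcomp_edges 0| = 1.
Proof.
apply/eqP; rewrite eqn_leq pcomp_neq0 andbT.
have c1 : #|pedges g (pidx f 0)| = 1 by rewrite pidx0; apply: pedges0_card.
by rewrite (leq_trans (max_card _)) // card_sub (leq_trans (max_card _)) //
  card_prod pedges0_card c1.
Qed.

Fact pcomp_comm n :
  oiso (ocomp (edges B n) (pcomp_edges n.+1))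
       (ocomp (pcomp_edges n) (epath D (pcomp_idx n) (pcomp_idx n.+1))).
Proof.
apply: oiso_trans (oiso_sym (oiso_assoc _ _ _)) _.
apply: oiso_trans (oiso_comp (pedges_comm f n) (oiso_refl _)) _.
apply: oiso_trans (oiso_assoc _ _ _) _.
apply: oiso_trans (oiso_sym (oiso_assoc _ _ _)).
exact: oiso_comp (oiso_refl _) (pedges_path g (pidx_le f n)).
Qed.

(* The composite usually written g f: first [f], then [g]. *)
Definition pcomp : premorphism B D :=
  Premorphism pcomp_idx0 pcomp_idx_le pcomp_idx_unbounded pcomp_neq0 pcomp_full
    pcomp0_card pcomp_comm.

End PremorphismComposition.

(* The sequences (n_k) and (m_k) of the definition are indexed from 0 here. *)
Definition pequiv (B C : obd) (f g : premorphism B C) : Prop :=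
  exists n m : nat -> nat, forall k,
    [/\ 0 < n k, 0 < m k, n k < m k < n k.+1,
        pidx f (n k) < pidx g (m k) < pidx f (n k.+1) &
        oiso (ocomp (epath B (n k) (m k)) (pedges g (m k)))
             (ocomp (pedges f (n k)) (epath C (pidx f (n k)) (pidx g (m k)))) /\
        oiso (ocomp (epath B (m k) (n k.+1)) (pedges f (n k.+1)))
             (ocomp (pedges g (m k))
                    (epath C (pidx g (m k)) (pidx f (n k.+1))))].

Section EquivalenceTheory.
Variables B C : obd.
Implicit Types f g h : premorphism B C.

Let square f g n m :=
  oiso (ocomp (epath B n m) (pedges g m))
       (ocomp (pedges f n) (epath C (pidx f n) (pidx g m))).

Let square_trans f g h n m q : n <= m -> m <= q ->
  pidx f n <= pidx g m -> pidx g m <= pidx h q ->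
  square f g n m -> square g h m q -> square f h n q.
Proof.
move=> nm mq fg gh sq1 sq2; rewrite /square.
apply: oiso_trans
  (oiso_comp (oiso_sym (epath_cat B nm mq)) (oiso_refl _)) _.
apply: oiso_trans (oiso_assoc _ _ _) _.
apply: oiso_trans (oiso_comp (oiso_refl _) sq2) _.
apply: oiso_trans (oiso_sym (oiso_assoc _ _ _)) _.
apply: oiso_trans (oiso_comp sq1 (oiso_refl _)) _.
apply: oiso_trans (oiso_assoc _ _ _) _.
exact: oiso_comp (oiso_refl _) (epath_cat C fg gh).
Qed.

Let cofinal f g := forall n, exists m,
  forall q, m <= q -> [/\ n < q, pidx f n < pidx g q & square f g n q].

Lemma pequiv_sym f g : pequiv f g -> pequiv g f.
Proof.
case=> n [m H]; exists m, (fun k => n k.+1) => k.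
have [_ m0 /andP[_ mn] /andP[_ gf] [_ s1]] := H k.
have [n0 _ /andP[nm _] /andP[fg _] [s2 _]] := H k.+1.
by split=> //; apply/andP; split.
Qed.

Let pequiv_cofinal f g : pequiv f g -> cofinal f g.
Proof.
case=> n [m H] p.
have kn k : k <= n k.
  elim: k => // k IH; have [_ _ /andP[nm mn] _ _] := H k.
  exact: leq_trans (leq_ltn_trans IH nm) (ltnW mn).
have [_ _ /andP[nm _] /andP[fg _] [sq _]] := H p.
exists (m p) => q mq; have nq := leq_trans nm mq.
have fpn := pidx_mono f (kn p); have gmq := pidx_mono g mq.
split.
- exact: leq_ltn_trans (kn p) nq.
- exact: leq_ltn_trans fpn (leq_trans fg gmq).
apply: (@square_trans f f g p (n p)) => //; first exact: ltnW.
- exact: leq_trans (ltnW fg) gmq.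
- exact: pedges_path.
apply: (@square_trans f g g _ (m p)) => //; try exact: ltnW.
exact: pedges_path.
Qed.

Let cofinal_pequiv f g : cofinal f g -> cofinal g f -> pequiv f g.
Proof.
move=> Hf Hg.
pose a n := proj1_sig (constructive_indefinite_description _ (Hf n)).
pose b n := proj1_sig (constructive_indefinite_description _ (Hg n)).
have Ha n : [/\ n < a n, pidx f n < pidx g (a n) & square f g n (a n)].
  by rewrite /a; case: constructive_indefinite_description => /= m; apply.
have Hb n : [/\ n < b n, pidx g n < pidx f (b n) & square g f n (b n)].
  by rewrite /b; case: constructive_indefinite_description => /= m; apply.
pose n k := iter k (b \o a) 1; exists n, (a \o n) => k /=.
have n0 : 0 < n k.
  elim: k => //= k IH; have [h _ _] := Ha (n k); have [h' _ _] := Hb (a (n k)).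
  exact: leq_trans (leq_trans IH (ltnW h)) (ltnW h').
have [h1 h2 h3] := Ha (n k); have [h1' h2' h3'] := Hb (a (n k)).
by split; rewrite ?h1 ?h2 //; apply: ltn_trans h1.
Qed.

Lemma pequiv_refl f : pequiv f f.
Proof.
suff H : cofinal f f by apply: cofinal_pequiv.
move=> n; have [m fm] := pidx_unbounded f (pidx f n).
have nm : n < m.
  by rewrite ltnNge; apply/negP=> /(pidx_mono f); rewrite leqNgt fm.
exists m => q mq; have nq := leq_trans nm mq.
split=> //; first exact: leq_trans fm (pidx_mono f mq).
exact: pedges_path (ltnW nq).
Qed.

Lemma pequiv_trans f g h : pequiv f g -> pequiv g h -> pequiv f h.
Proof.
have tr f1 f2 f3 : cofinal f1 f2 -> cofinal f2 f3 -> cofinal f1 f3.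
  move=> H1 H2 n; have [m /(_ m (leqnn m))[nm fg s1]] := H1 n.
  have [q Hq] := H2 m; exists q => p /Hq[mp gh s2]; split.
  - exact: ltn_trans mp.
  - exact: ltn_trans gh.
  by apply: (@square_trans f1 f2 f3 _ m); rewrite // ltnW.
move=> fg gh; apply: cofinal_pequiv.
  by apply: (tr f g h); apply: pequiv_cofinal.
by apply: (tr h g f); apply: pequiv_cofinal; apply: pequiv_sym.
Qed.

#[export] Instance pequiv_equivalence : Equivalence (@pequiv B C).
Proof. by split; [exact: pequiv_refl|exact: pequiv_sym|exact: pequiv_trans]. Qed.

End EquivalenceTheory.

Definition morphism (B C : obd) : Type :=
  {c : premorphism B C -> Prop | exists f, c = pequiv f}.

Definition mclass B C (f : premorphism B C) : morphism B C :=
  exist _ (pequiv f) (ex_intro _ f erefl).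

Record category (obj : Type) (hom : obj -> obj -> Type) := Category {
  cid : forall x, hom x x;
  ccomp : forall x y z, hom y z -> hom x y -> hom x z;
  ccomp_idl : forall x y (f : hom x y), ccomp (cid y) f = f;
  ccomp_idr : forall x y (f : hom x y), ccomp f (cid x) = f;
  ccomp_assoc : forall x y z t (h : hom z t) (g : hom y z) (f : hom x y),
    ccomp h (ccomp g f) = ccomp (ccomp h g) f
}.

Definition isomorphic (obj : Type) (hom : obj -> obj -> Type)
    (K : category hom) (x y : obj) : Prop :=
  exists (f : hom x y) (g : hom y x),
    ccomp K g f = cid K x /\ ccomp K f g = cid K y.

Definition hps_iso (B C : obd) : Prop :=
  exists (phi : forall n, vert B n -> vert C n)
         (psi : forall n, edges B n -> edges C n),
    (forall n, bijective (phi n)) /\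
    forall n, [/\ bijective (psi n),
      forall e, src (psi n e) = phi n (src e),
      forall e, rng (psi n e) = phi n.+1 (rng e) &
      forall e e', ele (psi n e) (psi n e') = ele e e'].

Section Telescoping.
Variables (B : obd) (n : nat -> nat).
Hypotheses (n0 : n 0 = 0) (n_lt : forall k, n k < n k.+1).

Let V k := vert B (n k).
Let E k : oedge (V k) (V k.+1) := epath B (n k) (n k.+1).

Fact telescope_full k : full_edges (E k).
Proof. exact: epath_full (ltnW (n_lt k)). Qed.

Fact telescope_neq0 k : 0 < #|E k|.
Proof. exact: full_neq0 (vert_neq0 B _) (telescope_full k). Qed.

Fact telescope_vert0 : #|V 0| = 1.
Proof. by rewrite /V n0 vert0_card. Qed.

Definition telescope : obd :=
  @OBD V E (fun k => vert_neq0 B (n k)) telescope_vert0 telescope_neq0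
    telescope_full.

End Telescoping.

Definition hps_step (B C : obd) : Prop :=
  hps_iso B C \/
  exists (n : nat -> nat) (n0 : n 0 = 0) (n_lt : forall k, n k < n k.+1),
    C = telescope B n0 n_lt.

Definition hps_equiv : obd -> obd -> Prop := clos_refl_sym_trans obd hps_step.

(* Main.v *)
(* For premorphisms f, g : B -> C, f ~ g holds iff for every n the edge sets F_n
   and G_n become isomorphic once both are prolonged to a common, sufficiently
   high level L of C; this relation is visibly symmetric, persists for larger L,
   and is respected by composition.

   A telescoping along n_k gives the inverse morphisms E_(k,n_k) : V_k -> V_(n_k)
   and id : V_(n_k) -> V_(n_k).  Conversely, given gf ~ id and fg ~ id, choose
   rapidly increasing levels p_0 = 0, q_0, p_1, q_1, ... alternately in B and C
   and let D have the vertex sets V_(p_0), W_(q_0), V_(p_1), W_(q_1), ... and the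
   edge sets F_(p_k) o S_(f(p_k), q_k) and G_(q_k) o E_(g(q_k), p_(k+1)).  Two
   consecutive edge sets compose to E_(p_k, p_(k+1)) or S_(q_k, q_(k+1)), so D
   and B share a telescoping (even levels), and so do D and C (level 0 and the
   odd levels), up to identifying the one-point sets V_0 and W_0. *)
From mathcomp Require Import all_boot zify.
From Stdlib Require Import Relation_Operators ClassicalEpsilon.
From Stdlib Require Import FunctionalExtensionality PropExtensionality.
From Stdlib Require Import Setoid Morphisms.
Require Import Defs.

Set Implicit Arguments.
Unset Strict Implicit.
Unset Printing Implicit Defensive.

(** * Rewriting with isomorphisms of ordered edge sets *)

Local Notation "F ~= G" := (oiso F G) (at level 70).
Local Notation "F >> G" := (ocomp F G) (at level 45, left associativity).

#[local] Instance oiso_equivalence (S T : finType) : Equivalence (@oiso S T).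
Proof. by split; [exact: oiso_refl|exact: oiso_sym|exact: oiso_trans]. Qed.

#[local] Hint Resolve oiso_refl : core.

#[local] Instance ocomp_proper (S T U : finType) :
  Proper (@oiso S T ==> @oiso T U ==> @oiso S U) (@ocomp S T U).
Proof. by move=> F F' FF' G G' GG'; apply: oiso_comp. Qed.

(** Edge sets are finite, so cardinalities replace the construction of an inverse. *)
Lemma oiso_inj_surj (S T : finType) (F G : oedge S T) (phi : F -> G) :
    injective phi -> (forall x, exists e, phi e = x) ->
    (forall e, src (phi e) = src e) -> (forall e, rng (phi e) = rng e) ->
    (forall e e', ele (phi e) (phi e') = ele e e') ->
  F ~= G.
Proof.
move=> injphi surj hs hr hl; exists phi; split=> //.
apply: inj_card_bij => //; rewrite -(card_codom injphi).
apply/subset_leq_card/subsetP => x _; have [e <-] := surj x.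
exact: codom_f.
Qed.

(** * Equivalence of premorphisms as eventual agreement *)

Section EventualAgreement.
Variables B C : obd.
Implicit Types f g : premorphism B C.

(** The two bounds exclude the junk value of [epath]: with [L] too small both prolonged edge sets
    would be empty, hence isomorphic. *)
Definition agree f g n L :=
  [/\ pidx f n <= L, pidx g n <= L &
      pedges f n >> epath C (pidx f n) L ~= pedges g n >> epath C (pidx g n) L].

Lemma agree_sym f g n L : agree f g n L -> agree g f n L.
Proof. by case=> fL gL fg; split=> //; apply: oiso_sym. Qed.

Lemma agree_leq f g n L M : L <= M -> agree f g n L -> agree f g n M.
Proof.
move=> LM [fL gL fg]; split.
- exact: leq_trans LM.
- exact: leq_trans LM.
by rewrite -(epath_cat C fL LM) -(epath_cat C gL LM) -!oiso_assoc fg.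
Qed.

(** Prefixing the square from [n p] to [m p] with the paths from [p] to [n p] makes it start at [p];
    [pedges_path] then moves these paths across [f] and [g]. *)
Lemma pequiv_agree f g : pequiv f g -> forall n, exists L, agree f g n L.
Proof.
case=> n [m H] p.
have pn : p <= n p.
  elim: p => // k IH; have [_ _ /andP[nm mn] _ _] := H k.
  exact: leq_trans (leq_ltn_trans IH nm) (ltnW mn).
have [_ _ /andP[/ltnW nm _] /andP[/ltnW fg _] [sq _]] := H p.
exists (pidx g (m p)); split.
- exact: leq_trans (pidx_mono f pn) fg.
- exact: (pidx_mono g (leq_trans pn nm)).
rewrite -(epath_cat C (pidx_mono f pn) fg) -oiso_assoc -(pedges_path f pn).
rewrite oiso_assoc -sq -oiso_assoc (epath_cat B pn nm).
exact: pedges_path (leq_trans pn nm).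
Qed.

(** Once the level [pidx g a] exceeds [L], [f] may be replaced by [g] at [n], and the square becomes
    the commutation of [g] with paths. *)
Lemma agree_square f g : (forall n, exists L, agree f g n L) ->
  forall n, exists a, [/\ n < a, pidx f n < pidx g a &
    epath B n a >> pedges g a ~= pedges f n >> epath C (pidx f n) (pidx g a)].
Proof.
move=> fg n; have [L afg] := fg n; have [fL gL _] := afg.
have [a La] := pidx_unbounded g L; exists a.
have na : n < a.
  by rewrite ltnNge; apply/negP=> /(pidx_mono g); rewrite leqNgt (leq_ltn_trans gL).
split=> //; first exact: leq_ltn_trans La.
have [_ _ ->] := agree_leq (ltnW La) afg; exact: pedges_path (ltnW na).
Qed.

Lemma agree_pequiv f g : (forall n, exists L, agree f g n L) -> pequiv f g.
Proof.
move=> fg.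
have gf n : exists L, agree g f n L.
  by have [L /agree_sym] := fg n; exists L.
have [a Ha] := choice _ (agree_square fg).
have [b Hb] := choice _ (agree_square gf).
(* [a] leads from an index for [f] to one for [g], and [b] leads back; the start is 1 because the
   indices must be positive. *)
pose n k := iter k (b \o a) 1; exists n, (a \o n) => k /=.
have n0 : 0 < n k.
  elim: k => //= k IH; have [h _ _] := Ha (n k); have [h' _ _] := Hb (a (n k)).
  exact: leq_trans (leq_trans IH (ltnW h)) (ltnW h').
have [h1 h2 h3] := Ha (n k); have [h1' h2' h3'] := Hb (a (n k)).
by split; rewrite ?h1 ?h2 //; apply: ltn_trans h1.
Qed.

End EventualAgreement.

(** Prolonged to [L], a composite splits at level [M] of [C] into two factors, one for each
    premorphism; [M] is chosen by agreement of [f] and [f'] at [n], then [L] by agreement of [g] and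
    [g'] at [M]. *)
Lemma pequiv_pcomp (B C D : obd) (f f' : premorphism B C)
    (g g' : premorphism C D) :
  pequiv f f' -> pequiv g g' -> pequiv (pcomp f g) (pcomp f' g').
Proof.
move=> /pequiv_agree ff' /pequiv_agree gg'; apply: agree_pequiv => n.
have [M [fM f'M eM]] := ff' n; have [L [gL g'L eL]] := gg' M; exists L.
have unfold_comp (h : premorphism B C) (k : premorphism C D) :
    pidx h n <= M -> pidx k M <= L ->
    pedges (pcomp h k) n >> epath D (pidx (pcomp h k) n) L
      ~= pedges h n >> epath C (pidx h n) M >> (pedges k M >> epath D (pidx k M) L).
  move=> hM kL; rewrite /= /pcomp_edges /pcomp_idx.
  rewrite -(epath_cat D (pidx_mono k hM) kL) oiso_assoc -(oiso_assoc (pedges k _)).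
  by rewrite -(pedges_path k hM) -!oiso_assoc.
split.
- exact: leq_trans (pidx_mono g fM) gL.
- exact: leq_trans (pidx_mono g' f'M) g'L.
by rewrite !unfold_comp // eM eL.
Qed.

(** * The category of ordered Bratteli diagrams *)

Section Identity.
Variable B : obd.

Fact oid_full (S : finType) : full_edges (oid S).
Proof. by split=> v; exists v. Qed.

Fact pid_comm n :
  edges B n >> oid (vert B n.+1) ~= oid (vert B n) >> epath B n n.+1.
Proof. by rewrite oiso_idr oiso_idl epath1. Qed.

Fact pid_unbounded N : exists n, N < n.
Proof. by exists N.+1. Qed.

Definition pid : premorphism B B :=
  @Premorphism B B id (fun n => oid (vert B n)) erefl leqnSn pid_unbounded
    (vert_neq0 B) (fun n => oid_full (vert B n)) (vert0_card B) pid_comm.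

End Identity.

Lemma pcomp_idl B C (f : premorphism B C) : pequiv (pcomp (pid B) f) f.
Proof.
apply: agree_pequiv => n; exists (pidx f n); split=> //=.
by rewrite /pcomp_edges /pcomp_idx /= oiso_idl.
Qed.

Lemma pcomp_idr B C (f : premorphism B C) : pequiv (pcomp f (pid C)) f.
Proof.
apply: agree_pequiv => n; exists (pidx f n); split=> //=.
by rewrite /pcomp_edges /pcomp_idx /= oiso_idr.
Qed.

Lemma pcomp_assoc B C D E (f : premorphism B C) (g : premorphism C D)
    (h : premorphism D E) :
  pequiv (pcomp (pcomp f g) h) (pcomp f (pcomp g h)).
Proof.
apply: agree_pequiv => n; exists (pidx (pcomp (pcomp f g) h) n); split=> //=.
exact: oiso_comp (oiso_assoc _ _ _) (oiso_refl _).
Qed.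

Section Morphisms.
Variables B C : obd.

Lemma mclassP (f g : premorphism B C) : mclass f = mclass g <-> pequiv f g.
Proof.
split=> [/(congr1 (@proj1_sig _ _)) /= ->|fg]; first exact: pequiv_refl.
apply: eq_sig_hprop => [c p q|]; first exact: proof_irrelevance.
apply: functional_extensionality => h; apply: propositional_extensionality.
by split=> [|gh]; [apply/pequiv_trans/pequiv_sym|apply: pequiv_trans gh].
Qed.

Definition repr (c : morphism B C) : premorphism B C :=
  proj1_sig (constructive_indefinite_description _ (proj2_sig c)).

Lemma mclass_repr c : mclass (repr c) = c.
Proof.
rewrite /repr; case: constructive_indefinite_description => /= f Ec.
by apply: eq_sig_hprop => [d p q|]; [exact: proof_irrelevance|rewrite /= Ec].
Qed.

End Morphisms.

(** Representatives are picked by choice; [mcomp_mclass] shows that the result does not depend on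
    them. *)
Definition mcomp B C D (g : morphism C D) (f : morphism B C) : morphism B D :=
  mclass (pcomp (repr f) (repr g)).

Lemma mcomp_mclass B C D (f : premorphism B C) (g : premorphism C D) :
  mcomp (mclass g) (mclass f) = mclass (pcomp f g).
Proof. by apply/mclassP/pequiv_pcomp; apply/mclassP; rewrite mclass_repr. Qed.

Lemma mcomp_idl B C (f : morphism B C) : mcomp (mclass (pid C)) f = f.
Proof. by rewrite -(mclass_repr f) mcomp_mclass; apply/mclassP/pcomp_idr. Qed.

Lemma mcomp_idr B C (f : morphism B C) : mcomp f (mclass (pid B)) = f.
Proof. by rewrite -(mclass_repr f) mcomp_mclass; apply/mclassP/pcomp_idl. Qed.

Lemma mcomp_assoc B C D E (h : morphism D E) (g : morphism C D)
    (f : morphism B C) : mcomp h (mcomp g f) = mcomp (mcomp h g) f.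
Proof.
rewrite -(mclass_repr f) -(mclass_repr g) -(mclass_repr h) !mcomp_mclass.
exact/mclassP/pcomp_assoc.
Qed.

Definition OBDcat : category morphism :=
  Category mcomp_idl mcomp_idr mcomp_assoc.

Lemma isomorphicP B C : isomorphic OBDcat B C <->
  exists (f : premorphism B C) (g : premorphism C B),
    pequiv (pcomp f g) (pid B) /\ pequiv (pcomp g f) (pid C).
Proof.
split=> [[f [g]]|[f [g [gf fg]]]].
  rewrite -(mclass_repr f) -(mclass_repr g) /= !mcomp_mclass.
  by case=> /mclassP gf /mclassP fg; exists (repr f), (repr g).
by exists (mclass f), (mclass g); rewrite /= !mcomp_mclass; split; apply/mclassP.
Qed.

(** * From Herman-Putnam-Skau equivalence to isomorphism *)

Section CategoryIsomorphism.
Variables (obj : Type) (hom : obj -> obj -> Type) (K : category hom).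

Lemma isomorphic_refl x : isomorphic K x x.
Proof. by exists (cid K x), (cid K x); rewrite ccomp_idl. Qed.

Lemma isomorphic_sym x y : isomorphic K x y -> isomorphic K y x.
Proof. by case=> f [g [gf fg]]; exists g, f. Qed.

Lemma isomorphic_trans x y z :
  isomorphic K x y -> isomorphic K y z -> isomorphic K x z.
Proof.
case=> f [g [gf fg]] [f' [g' [gf' fg']]].
exists (ccomp K f' f), (ccomp K g g'); split.
  by rewrite -ccomp_assoc (ccomp_assoc K g') gf' ccomp_idl.
by rewrite -ccomp_assoc (ccomp_assoc K f) fg ccomp_idl.
Qed.

End CategoryIsomorphism.

Section Graph.
Variables (S T : finType) (phi : S -> T).
Hypothesis phi_inj : injective phi.

Fact ograph_comparable (x y : S) : ((x == y) || (y == x)) = (phi x == phi y).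
Proof. by rewrite (eq_sym y) orbb inj_eq. Qed.

(** Injectivity of [phi] leaves at most one edge for each range, so equality is an admissible
    order. *)
Definition ograph : oedge S T :=
  @OEdge S T S id phi eq_op (@oid_refl S) (@oid_anti S) (@oid_trans S)
    ograph_comparable.

End Graph.

Lemma ograph_comp (S T : finType) (phi : S -> T) (psi : T -> S)
    (phi_inj : injective phi) (psi_inj : injective psi) :
  cancel phi psi -> ograph phi_inj >> ograph psi_inj ~= oid S.
Proof.
move=> phiK.
apply: (@oiso_inj_surj _ _ (ograph phi_inj >> ograph psi_inj) (oid S)
         (fun e => (val e).1)) => //=.
- case=> [[x y] /= xy] [[x' y'] /= xy'] /= E; apply: val_inj => /=.
  by rewrite -(eqP xy) -(eqP xy') E.
- by move=> x; exists (exist _ (x, phi x) (eqxx (phi x))).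
- by case=> [[x y] /= xy]; rewrite -(eqP xy) phiK.
- case=> [[x y] /= xy] [[x' y'] /= xy'] /=.
  rewrite /ocomp_le /= -(eqP xy) -(eqP xy') (inj_eq phi_inj).
  by case: eqVneq.
Qed.

Lemma bijective_inverse (A : Type) (S T : A -> Type)
    (phi : forall a, S a -> T a) : (forall a, bijective (phi a)) ->
  exists phi' : forall a, T a -> S a,
    forall a, cancel (phi a) (phi' a) /\ cancel (phi' a) (phi a).
Proof.
move=> phi_bij.
have inv a : exists psi : T a -> S a, cancel (phi a) psi /\ cancel psi (phi a).
  by have [psi K K'] := phi_bij a; exists psi.
exists (fun a => proj1_sig (constructive_indefinite_description _ (inv a))) => a.
by case: constructive_indefinite_description.
Qed.

Section IsoPremorphism.
Variables (B C : obd) (phi : forall n, vert B n -> vert C n).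
Variables (psi : forall n, edges B n -> edges C n).
Arguments phi : clear implicits.
Arguments psi : clear implicits.
Hypotheses (phi_bij : forall n, bijective (phi n)).
Hypothesis psiP : forall n, [/\ bijective (psi n),
      forall e, src (psi n e) = phi n (src e),
      forall e, rng (psi n e) = phi n.+1 (rng e) &
      forall e e', ele (psi n e) (psi n e') = ele e e'].

Let phi_inj n : injective (phi n) := bij_inj (phi_bij n).
Let G n := ograph (@phi_inj n).

Fact iso_premorphism_full n : full_edges (G n).
Proof.
split=> [v|w]; first by exists v.
by have [phi' _ K] := phi_bij n; exists (phi' w); rewrite /= K.
Qed.

(** In each pair the graph edge is determined by the diagram edge next to it, so [psi] alone gives
    the bijection. *)
Fact iso_premorphism_comm n : edges B n >> G n.+1 ~= G n >> epath C n n.+1.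
Proof.
rewrite epath1; have [psi_bij hs hr hl] := psiP n.
have P (e : edges B n >> G n.+1) :
  rng (src (val e).1 : G n) == src (psi n (val e).1) by rewrite /= hs.
pose chi (e : edges B n >> G n.+1) : G n >> edges C n :=
  exist (fun q : G n * edges C n => rng q.1 == src q.2)
    (src (val e).1, psi n (val e).1) (P e).
apply: (oiso_inj_surj (phi := chi)) => //=.
- case=> [[x y] /= xy] [[x' y'] /= xy'] /(congr1 val) [] _.
  move/(bij_inj psi_bij)=> E; apply: val_inj => /=.
  by rewrite -(eqP xy) -(eqP xy') E.
- case=> [[v e] /= ve]; have [psi' _ K] := psi_bij.
  exists (exist (fun q : edges B n * G n.+1 => rng q.1 == src q.2)
           (psi' e, rng (psi' e)) (eqxx _)).
  apply: val_inj; rewrite /= K; congr pair.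
  by apply: phi_inj; rewrite -hs K (eqP ve).
- by case=> [[x y] /= xy]; rewrite -(eqP xy) hr.
- case=> [[x y] /= xy] [[x' y'] /= xy'] /=.
  rewrite /ocomp_le /= hl -(eqP xy) -(eqP xy') (inj_eq (bij_inj psi_bij)).
  case: (eqVneq x x') => [<-|xx'] /=; first by rewrite !eqxx ele_refl.
  rewrite orbF; case: eqVneq => //= rr.
  by apply/negP=> le; have := ele_comparable x x'; rewrite le (negbTE rr).
Qed.

Definition iso_premorphism : premorphism B C :=
  @Premorphism B C id G erefl leqnSn pid_unbounded (vert_neq0 B)
    iso_premorphism_full (vert0_card B) iso_premorphism_comm.


End IsoPremorphism.

Lemma hps_iso_isomorphic B C : hps_iso B C -> isomorphic OBDcat B C.
Proof.
case=> phi [psi [phi_bij psiP]].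
have psi_bij n : bijective (psi n) by have [] := psiP n.
have [phi' phiK] := bijective_inverse phi_bij.
have [psi' psiK] := bijective_inverse psi_bij.
have phi'_bij n : bijective (phi' n).
  by have [K K'] := phiK n; exists (phi n).
have psi'P n : [/\ bijective (psi' n),
    forall e, src (psi' n e) = phi' n (src e),
    forall e, rng (psi' n e) = phi' n.+1 (rng e) &
    forall e e', ele (psi' n e) (psi' n e') = ele e e'].
  have [K K'] := psiK n; have [_ hs hr hl] := psiP n.
  split=> [|e|e|e e'].
  - by exists (psi n).
  - by rewrite -{2}(K' e) hs (phiK n).1.
  - by rewrite -{2}(K' e) hr (phiK n.+1).1.
  - by rewrite -hl !K'.
apply/isomorphicP.
exists (iso_premorphism phi_bij psiP), (iso_premorphism phi'_bij psi'P).
split; apply: agree_pequiv => n; exists n; split=> //=;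
  apply: oiso_comp => //; apply: ograph_comp; exact: (phiK n).1 || exact: (phiK n).2.
Qed.

Section TelescopePremorphisms.
Variables (B : obd) (n : nat -> nat).
Hypotheses (n0 : n 0 = 0) (n_lt : forall k, n k < n k.+1).
Let T := telescope B n0 n_lt.

Fact telescope_idx_mono k l : k <= l -> n k <= n l.
Proof. exact: (homo_leq (@leqnn) (@leq_trans) (fun k => ltnW (n_lt k))). Qed.

Fact telescope_idx_geq k : k <= n k.
Proof. by elim: k => // k /leq_ltn_trans; apply. Qed.

Lemma epath_telescope k l : k <= l -> epath T k l ~= epath B (n k) (n l).
Proof.
elim: l => [|l IH].
  by rewrite leqn0 => /eqP->; rewrite (epath_id T 0) epath_id.
rewrite leq_eqVlt ltnS => /orP[/eqP->|kl]; first by rewrite !epath_id.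
rewrite epathS // IH // -(epath_cat B (telescope_idx_mono kl) (ltnW (n_lt l))).
exact: oiso_refl.
Qed.

Fact to_telescope_full k : full_edges (epath B k (n k)).
Proof. exact/epath_full/telescope_idx_geq. Qed.

Fact to_telescope0 : #|epath B 0 (n 0)| = 1.
Proof. by rewrite n0 epath_id /= vert0_card. Qed.

Fact to_telescope_comm k : edges B k >> epath B k.+1 (n k.+1)
  ~= epath B k (n k) >> epath T k k.+1.
Proof.
rewrite epath_telescope // epath_cat ?telescope_idx_geq //; last exact: ltnW.
by rewrite -epath1 epath_cat ?telescope_idx_geq.
Qed.

Definition to_telescope : premorphism B T :=
  @Premorphism B T id (fun k => epath B k (n k)) erefl leqnSn pid_unbounded
    (fun k => full_neq0 (vert_neq0 B k) (to_telescope_full k))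
    to_telescope_full to_telescope0 to_telescope_comm.

Fact of_telescope_unbounded N : exists k, N < n k.
Proof. by exists N.+1; apply: telescope_idx_geq. Qed.

Fact of_telescope_comm k : edges T k >> oid (vert B (n k.+1))
  ~= oid (vert B (n k)) >> epath B (n k) (n k.+1).
Proof. by rewrite oiso_idr oiso_idl. Qed.

Definition of_telescope : premorphism T B :=
  @Premorphism T B n (fun k => oid (vert B (n k))) n0 (fun k => ltnW (n_lt k))
    of_telescope_unbounded (fun k => vert_neq0 B (n k))
    (fun k => oid_full (vert B (n k))) (telescope_vert0 B n0) of_telescope_comm.

Lemma telescope_isomorphic : isomorphic OBDcat B T.
Proof.
apply/isomorphicP; exists to_telescope, of_telescope.
(* The number [n k] is a level of [B] for the first composite and a level of [T] for the second. *)
split; apply: agree_pequiv => k; exists (n k); have kn := telescope_idx_geq k.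
  split=> //=; rewrite /pcomp_edges /pcomp_idx /= epath_id oiso_idl.
  by rewrite [X in X >> _]oiso_idr oiso_idr.
split=> //=; rewrite /pcomp_edges /pcomp_idx /= (epath_id T) !oiso_idl.
by rewrite oiso_idr epath_telescope.
Qed.

End TelescopePremorphisms.

Lemma hps_equiv_isomorphic B C : hps_equiv B C -> isomorphic OBDcat B C.
Proof.
elim=> {B C} [B C [BC|[n [n0 [n_lt ->]]]]|B|B C _|B C D _ BC _].
- exact: hps_iso_isomorphic.
- exact: telescope_isomorphic.
- exact: isomorphic_refl.
- exact: isomorphic_sym.
- exact: isomorphic_trans.
Qed.

(** * Diagrams given by index sequences *)

Lemma hps_iso_oiso (V : nat -> finType)
    (E E' : forall n, oedge (V n) (V n.+1)) V_neq0 V0 E_neq0 E_full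
    V_neq0' V0' E_neq0' E_full' :
  (forall n, E n ~= E' n) ->
  hps_iso (@OBD V E V_neq0 V0 E_neq0 E_full)
          (@OBD V E' V_neq0' V0' E_neq0' E_full').
Proof.
move=> EE'; exists (fun _ => id).
exists (fun n => proj1_sig (constructive_indefinite_description _ (EE' n))).
split=> n; first by exists id.
by case: constructive_indefinite_description.
Qed.

Definition seq_cons (I : Type) (a : I) (t : nat -> I) n :=
  if n is m.+1 then t m else a.

Lemma card1_unique (T : finType) : #|T| = 1 -> exists x : T, forall y, y = x.
Proof. by move/eqP/fintype1P=> [x xP]; exists x => y; apply: xP. Qed.

Section SequenceDiagrams.
Variables (I : Type) (X : I -> finType) (Z : forall i j, oedge (X i) (X j)).
Hypothesis X_neq0 : forall i, 0 < #|X i|.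

(** The interleaved diagram and the diagrams compared with its telescopings all come from one family
    [X], [Z]; only the index sequence changes. *)
Definition seq_obd (i : nat -> I) (i0 : #|X (i 0)| = 1)
    (i_full : forall k, full_edges (Z (i k) (i k.+1))) : obd :=
  @OBD (fun k => X (i k)) (fun k => Z (i k) (i k.+1)) (fun k => X_neq0 (i k)) i0
    (fun k => full_neq0 (X_neq0 (i k)) (i_full k)) i_full.

(** Level 0 is a point on both sides, so [psi] respects sources automatically. *)
Lemma seq_obd_cons a b (t : nat -> I) a0 a_full b0 b_full
    (psi : Z a (t 0) -> Z b (t 0)) :
    bijective psi -> (forall e, rng (psi e) = rng e) ->
    (forall e e', ele (psi e) (psi e') = ele e e') ->
  hps_iso (@seq_obd (seq_cons a t) a0 a_full) (@seq_obd (seq_cons b t) b0 b_full).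
Proof.
move=> psi_bij psi_rng psi_ele.
have [x Xa] := card1_unique (a0 : #|X a| = 1).
have [y Xb] := card1_unique (b0 : #|X b| = 1).
exists (fun n => if n is m.+1 return X (seq_cons a t n) -> X (seq_cons b t n)
                 then id else fun=> y).
exists (fun n => if n is m.+1
                   return Z (seq_cons a t n) (seq_cons a t n.+1) ->
                          Z (seq_cons b t n) (seq_cons b t n.+1)
                 then id else psi).
split; last by case=> [|n]; split=> //; exists id.
case=> [|n]; last by exists id.
by exists (fun=> x : X a) => z; [exact/esym/Xa|exact/esym/Xb].
Qed.

(** Substituting the sequence [j] as a whole makes the vertex sets of both diagrams the same types,
    so no casts arise. *)
Lemma seq_obd_telescope (i : nat -> I) i0 i_full t t0 t_lt (j : nat -> I) j0 j_full :
  (forall k, j k = i (t k)) ->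
  (forall k, epath (@seq_obd i i0 i_full) (t k) (t k.+1)
             ~= Z (i (t k)) (i (t k.+1))) ->
  hps_iso (@telescope (@seq_obd i i0 i_full) t t0 t_lt) (@seq_obd j j0 j_full).
Proof.
move=> jE; have {jE} ? : j = fun k => i (t k) by apply: functional_extensionality.
by subst j; apply: hps_iso_oiso.
Qed.

(** Gaps of one and two suffice: the telescopings of the interleaved diagram omit at most one level
    at a time. *)
Lemma seq_obd_epath (i : nat -> I) i0 i_full m n :
    (forall k, Z (i k) (i k.+1) >> Z (i k.+1) (i k.+2) ~= Z (i k) (i k.+2)) ->
    n = m.+1 \/ n = m.+2 ->
  epath (@seq_obd i i0 i_full) m n ~= Z (i m) (i n).
Proof.
move=> skip [->|->]; first exact: epath1.
rewrite epathS // epath1; exact: skip.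
Qed.

End SequenceDiagrams.

(** By fullness every vertex of [T] is the range of the single edge, so each edge of [G] extends in
    exactly one way. With [F] the initial edge set of a premorphism this identifies the top levels
    of the two diagrams. *)
Lemma single_edge_comp (S T U : finType) (F : oedge S T) (G : oedge T U) :
  #|F| = 1 -> full_edges F -> exists psi : F >> G -> G,
    [/\ bijective psi, forall e, rng (psi e) = rng e &
        forall e e', ele (psi e) (psi e') = ele e e'].
Proof.
move=> /card1_unique[x xP] [_ rF].
have P (g : G) : rng x == src g by have [e <-] := rF (src g); rewrite (xP e).
exists (fun e => (val e).2); split=> //.
  exists (fun g => exist (fun q : F * G => rng q.1 == src q.2) (x, g) (P g)) => //.
  by case=> [[e g] h]; apply: val_inj; rewrite /= (xP e).
case=> [[e g] h] [[e' g'] h']; rewrite /= /ocomp_le /= (xP e) (xP e') ele_refl.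
by case: eqVneq => [<-|_] /=; rewrite ?ele_refl ?orbF.
Qed.

(** * The interleaved diagram of an isomorphism *)

Section Zigzag.
Variables (B C : obd) (f : premorphism B C) (g : premorphism C B).

(** Moving the path in [C] across [g] leaves the composite premorphism prolonged to [p'], where it
    agrees with the identity. Exchanging [f] and [g] gives the same for [C]. *)
Lemma zigzag_skip p q p' : pidx f p <= q -> pidx g q <= p' ->
    agree (pcomp f g) (pid B) p p' ->
  (pedges f p >> epath C (pidx f p) q) >> (pedges g q >> epath B (pidx g q) p')
    ~= epath B p p'.
Proof.
move=> fq gp' [_ _]; rewrite /= oiso_idl => <-.
rewrite /pcomp_edges /pcomp_idx -(epath_cat B (pidx_mono g fq) gp').
rewrite !oiso_assoc -(oiso_assoc (epath C _ _)) (pedges_path g fq).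
by rewrite !oiso_assoc.
Qed.

(* Levels of B are indexed by [inl p] and levels of C by [inr q]; indexing by
   values instead of by the parity of a position avoids dependent casts. *)
Definition zvert (i : nat + nat) : finType :=
  match i with inl p => vert B p | inr q => vert C q end.

(** The mixed cases are the edge sets of the interleaved diagram; the other two are what its
    two-step composites should be. *)
Definition zedge (i j : nat + nat) : oedge (zvert i) (zvert j) :=
  match i, j with
  | inl p, inl p' => epath B p p'
  | inl p, inr q => pedges f p >> epath C (pidx f p) q
  | inr q, inl p => pedges g q >> epath B (pidx g q) p
  | inr q, inr q' => epath C q q'
  end.

Lemma zvert_neq0 i : 0 < #|zvert i|.
Proof. by case: i => n; apply: vert_neq0. Qed.

Lemma zedge_full_lr p q : pidx f p <= q -> full_edges (zedge (inl p) (inr q)).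
Proof. by move=> fq; apply: full_comp (pedges_full f p) (epath_full C fq). Qed.

Lemma zedge_full_rl q p : pidx g q <= p -> full_edges (zedge (inr q) (inl p)).
Proof. by move=> gp; apply: full_comp (pedges_full g q) (epath_full B gp). Qed.

End Zigzag.

(** [F] and [G] stand for the index sequences of the premorphisms, [TB] and [TC] for levels where
    the composites agree with the identities. Each new level is a maximum of the bounds imposed on
    it. *)
Lemma zigzag_levels (F G TB TC : nat -> nat) : exists p q : nat -> nat,
  [/\ p 0 = 0, 0 < q 0 & forall k,
  [/\ p k < p k.+1, q k < q k.+1, F (p k) <= q k & G (q k) <= p k.+1] /\
  TB (p k) <= p k.+1 /\ TC (q k) <= q k.+1].
Proof.
pose next (s : nat * nat) :=
  let p' := maxn s.1.+1 (maxn (G s.2) (TB s.1)) in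
  (p', maxn s.2.+1 (maxn (F p') (TC s.2))).
(* The successor makes [q 0] positive, so that prefixing 0 to [q] still gives a strictly increasing
   sequence. *)
pose st k := iter k next (0, (F 0).+1).
exists (fun k => (st k).1), (fun k => (st k).2); split=> // k.
have Fk : F (st k).1 <= (st k).2 by case: k => [|k] /=; lia.
by rewrite /=; split; [split|]; lia.
Qed.

Lemma isomorphic_hps_equiv B C : isomorphic OBDcat B C -> hps_equiv B C.
Proof.
case/isomorphicP=> f [g [/pequiv_agree gf /pequiv_agree fg]].
have [TB agB] := choice _ gf; have [TC agC] := choice _ fg.
have [p [q [p0 q0 H]]] := zigzag_levels (pidx f) (pidx g) TB TC.
pose Z := zedge f g.
pose i n : nat + nat := if odd n then inr (q n./2) else inl (p n./2).
have i_even k : i k.*2 = inl (p k) by rewrite /i odd_double doubleK.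
have i_odd k : i k.*2.+1 = inr (q k) by rewrite /i /= odd_double /= uphalf_double.
have i_even2 k : i k.*2.+2 = inl (p k.+1) by rewrite -doubleS i_even.
have parity n : exists k, n = k.*2 \/ n = k.*2.+1.
  exists n./2; rewrite -{1 3}(odd_double_half n).
  by case: (odd n); [right|left].
have i_full n : full_edges (Z (i n) (i n.+1)).
  have [k [->|->]] := parity n; have [[_ _ fq gp] _] := H k.
    by rewrite i_even i_odd; apply: zedge_full_lr.
  by rewrite i_odd i_even2; apply: zedge_full_rl.
have skip n : Z (i n) (i n.+1) >> Z (i n.+1) (i n.+2) ~= Z (i n) (i n.+2).
  have [k [->|->]] := parity n; have [[_ _ fq gp] [tB tC]] := H k.
    rewrite i_even i_odd i_even2; apply: zigzag_skip => //.
    exact: agree_leq tB (agB (p k)).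
  have [[_ _ fq' _] _] := H k.+1.
  rewrite -doubleS i_odd i_even i_odd; apply: zigzag_skip => //.
  exact: agree_leq tC (agC (q k)).
have i0 : #|zvert B C (i 0)| = 1 by rewrite /i /= p0 vert0_card.
pose D := seq_obd (zvert_neq0 B C) i0 i_full.
have step A A' : hps_iso A A' -> hps_equiv A A' by move=> AA'; apply: rst_step; left.
have tel A n n0 n_lt : hps_equiv A (@telescope A n n0 n_lt).
  by apply: rst_step; right; exists n, n0, n_lt.
have BD : hps_equiv B D.
  have p_lt k : p k < p k.+1 by have [[]] := H k.
  have dbl_lt k : k.*2 < k.+1.*2 by rewrite ltn_double.
  pose j k : nat + nat := inl (p k).
  have j0 : #|zvert B C (j 0)| = 1 by rewrite /= p0 vert0_card.
  have j_full k : full_edges (Z (j k) (j k.+1)) by exact/epath_full/ltnW.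
  pose B' := seq_obd (zvert_neq0 B C) j0 j_full.
  apply: rst_trans (tel B p p0 p_lt) _.
  apply: (@rst_trans _ _ _ B'); first exact/step/hps_iso_oiso.
  apply: rst_sym; apply: rst_trans (tel D double erefl dbl_lt) _.
  apply/step/seq_obd_telescope => k; first by rewrite i_even.
  by apply: seq_obd_epath => //; right; rewrite doubleS.
apply: rst_trans BD _.
(* [j (inl 0)] and [j (inr 0)] differ only in their top level, which is that of [B] or that of
   [C]. *)
pose j a := seq_cons a (fun k => inr (q k) : nat + nat).
(* Positions 0, 1, 3, 5, ...: the first gap is one, all later gaps are two. *)
pose t := seq_cons 0 (fun k => k.*2.+1).
pose c := seq_cons 0 q.
have t_lt k : t k < t k.+1 by case: k => //= k; rewrite doubleS.
have c_lt k : c k < c k.+1 by case: k => //= k; have [[]] := H k.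
have ji k : j (inl 0) k = i (t k).
  by case: k => [|k] /=; rewrite ?i_odd // /i /= p0.
have jc k : j (inr 0) k = inr (c k) by case: k.
have jl0 : #|zvert B C (j (inl 0) 0)| = 1 by rewrite /= vert0_card.
have jr0 : #|zvert B C (j (inr 0) 0)| = 1 by rewrite /= vert0_card.
have jl_full k : full_edges (Z (j (inl 0) k) (j (inl 0) k.+1)).
  case: k => [|k]; first by apply: zedge_full_lr; rewrite pidx0.
  exact: epath_full (ltnW (c_lt k.+1)).
have jr_full k : full_edges (Z (j (inr 0) k) (j (inr 0) k.+1)).
  by rewrite !jc; apply: epath_full (ltnW (c_lt k)).
pose D' := seq_obd (zvert_neq0 B C) jl0 jl_full.
pose C' := seq_obd (zvert_neq0 B C) jr0 jr_full.
apply: rst_trans (tel D t erefl t_lt) _.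
apply: (@rst_trans _ _ _ D').
  apply/step/seq_obd_telescope => // k; apply: seq_obd_epath => //.
  by case: k => [|k]; [left|right].
apply: (@rst_trans _ _ _ C').
  have [psi []] : exists psi : Z (inl 0) (inr (q 0)) -> Z (inr 0) (inr (q 0)),
      [/\ bijective psi, forall e, rng (psi e) = rng e &
          forall e e', ele (psi e) (psi e') = ele e e'].
    (* The type of [pedges f 0] mentions [pidx f 0], so the edge set is generalized before that
       index is rewritten to 0. *)
    rewrite /Z /=; move: (pedges f 0) (pedges0_card f) (pedges_full f 0).
    by rewrite pidx0 => F; apply: single_edge_comp.
  move=> psi_bij psi_rng psi_ele; apply/step.
  exact: (seq_obd_cons (a := inl 0) (b := inr 0) _ _ _ _ _ psi_bij).
apply: rst_sym; apply: rst_trans (tel C c erefl c_lt) _.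
(* The two sequences agree only after a case split on [k]; equating them as functions makes the
   vertex sets coincide. *)
have jcE : j (inr 0) = fun k => inr (c k) by apply: functional_extensionality.
apply/step; rewrite {}/C'; move: jr0 jr_full; rewrite jcE => jr0 jr_full.
exact: hps_iso_oiso.
Qed.

Theorem proposition2p9 :
  exists K : category morphism,
    (forall (B C D : obd) (f : premorphism B C) (g : premorphism C D),
       ccomp K (mclass g) (mclass f) = mclass (pcomp f g)) /\
    (forall B C : obd, isomorphic K B C <-> hps_equiv B C).
Proof.
exists OBDcat; split; first exact: mcomp_mclass.
by move=> B C; split; [exact: isomorphic_hps_equiv|exact: hps_equiv_isomorphic].
Qed.
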